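(* Let $G=(V(G),E(G))$ be a finite simple graph with four vertices $u,v,w,z$ such that $uz,wz,vw\in E(G)$ and $uw,vz,uv\notin E(G)$. Suppose there is a graph automorphism $\varphi$ of the graph $(V(G),E(G)\setminus\{wz\})$ such that $\varphi(\{u,w\})=\{v,z\}$ and $\varphi(\{v,z\})=\{u,w\}$. Then the graphs $H=(V(G),E(G)\cup\{uw\})$ and $J=(V(G),E(G)\cup\{vz\})$ satisfy $\mathbf{X}_H=\mathbf{X}_J$.
   Context: The chromatic symmetric function of a finite simple graph $G$ is $\mathbf{X}_G=\sum_{\kappa}\prod_{v\in V(G)} x_{\kappa(v)}$, where $x_1,x_2,\dots$ are commuting indeterminates and the sum is over all proper colorings $\kappa:V(G)\to\{1,2,3,\dots\}$ (i.e. $\kappa(u)\neq\kappa(v)$ whenever $uv\in E(G)$). *)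

(* Defs.v *)
From mathcomp Require Import all_boot all_order all_algebra perm.
From mathcomp Require Import boolp classical_sets cardinality fsbigop.
From mathcomp Require Import finmap monalg.

Set Implicit Arguments.
Unset Strict Implicit.
Unset Printing Implicit Defensive.

Import GRing.Theory.
Local Open Scope ring_scope.

(* The graph (V, E), with E a set of unordered pairs of vertices. *)
Definition simple_graph (V : finType) (E : {set {set V}}) : Prop :=
  forall e : {set V}, e \in E -> #|e| = 2%N.

Definition graph_automorphism (V : finType) (E : {set {set V}})
    (phi : {perm V}) : Prop :=
  forall x y : V, ([set phi x; phi y] \in E) = ([set x; y] \in E).

(* Colours are the positive integers. *)
Definition proper_coloring (V : finType) (E : {set {set V}})
    (kappa : {ffun V -> nat}) : Prop :=
  (forall x : V, (0 < kappa x)%N) /\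
  (forall x y : V, [set x; y] \in E -> kappa x <> kappa y).

(* Formal power series in the commuting indeterminates x_i (i : nat), as
   coefficient functions on monomials; x_0 never occurs in what follows. *)
Definition power_series : Type := {cmonom nat} -> int.

Definition indet (i : nat) : {malg int[{cmonom nat}]} := << ucm i >>.

(* The infinite sum is taken coefficientwise.  [\sum_(_ \in _)] ranges over the
   indices with nonzero term and is only meaningful when these are finitely
   many; see [chromatic_symmetric_function_finite]. *)
Definition chromatic_symmetric_function (V : finType) (E : {set {set V}}) :
    power_series :=
  fun m => \sum_(kappa \in [set kappa | proper_coloring E kappa]%classic)
             mcoeff m (\prod_(x : V) indet (kappa x)).

Lemma prod_indetE (V : finType) (kappa : {ffun V -> nat}) :
  \prod_(x : V) indet (kappa x) =
  << (\big[mmul/mone]_(x : V) ucm (kappa x)) >>.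
Proof.
elim/big_rec2: _ => [|x m p _ ->]; first by [].
by rewrite /indet malgM_def fgmulUU mulr1.
Qed.

Lemma chromatic_symmetric_function_finite (V : finType) (E : {set {set V}})
    (m : {cmonom nat}) :
  finite_set [set kappa : {ffun V -> nat} | proper_coloring E kappa /\
    mcoeff m (\prod_(x : V) indet (kappa x)) <> 0]%classic.
Proof.
pose N := (\max_(i <- finsupp m) i)%N.
pose f (g : {ffun V -> 'I_N.+1}) : {ffun V -> nat} := [ffun x => g x : nat].
apply: (@sub_finite_set _ _ (f @` setT)%classic); last first.
  exact/finite_image/finite_finset.
move=> kappa [_]; rewrite prod_indetE mcoeffU1.
case: eqP => // def_m _.
exists [ffun x => inord (kappa x)] => //.
apply/ffunP => x; rewrite !ffunE inordK // ltnS.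
apply: leq_bigmax_seq => //.
by rewrite -cmE_neq0 -def_m (bigD1 x) //= cmM cmUU.
Qed.

(* Main.v *)
(** Let F = E \ wz.  A colouring is proper for H iff it is proper for F and
    separates w from z and u from w, and proper for J iff it is proper for F and
    separates w from z and v from z.  Hence a proper colouring of H that is not
    proper for J satisfies k v = k z.  Since phi exchanges {u, w} and {v, z}, the
    colouring k \o phi then identifies u with w and separates v from z; it
    also separates w from z, because its value at w is its value at u and uz is
    an edge of F.  So "precompose with phi when k v = k z, else do nothing" is a
    weight-preserving bijection from the proper colourings of H to those of J. *)
Require Import Defs.
From mathcomp Require Import all_boot all_order all_algebra perm.
From mathcomp Require Import boolp classical_sets functions fsbigop.
From mathcomp Require Import finmap monalg.

Local Open Scope ring_scope.

Definition coloring_comp (V : finType) (phi : {perm V}) (k : {ffun V -> nat}) :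
  {ffun V -> nat} := [ffun x => k (phi x)].

Lemma coloring_compK (V : finType) (phi : {perm V}) :
  cancel (coloring_comp V phi) (coloring_comp V phi^-1%g).
Proof. by move=> k; apply/ffunP => x; rewrite !ffunE permKV. Qed.

Lemma coloring_compVK (V : finType) (phi : {perm V}) :
  cancel (coloring_comp V phi^-1%g) (coloring_comp V phi).
Proof. by move=> k; apply/ffunP => x; rewrite !ffunE permK. Qed.

Lemma proper_coloring_comp (V : finType) (E : {set {set V}}) (phi : {perm V})
    (k : {ffun V -> nat}) :
  graph_automorphism E phi -> proper_coloring E k ->
  proper_coloring E (coloring_comp V phi k).
Proof.
move=> aut [k_gt0 kP]; split=> [x|x y xyE]; rewrite !ffunE //.
by apply: kP; rewrite aut.
Qed.

Lemma proper_coloringU1 (V : finType) (E : {set {set V}}) (x y : V)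
    (k : {ffun V -> nat}) :
  proper_coloring ([set x; y] |: E) k <-> proper_coloring E k /\ k x <> k y.
Proof.
split=> [[k_gt0 kP]|[[k_gt0 kP] kxy]].
  split; last by apply: kP; rewrite setU11.
  by split=> // a b abE; apply: kP; rewrite setU1r.
split=> // a b /setU1P[ab|/kP//] kab; apply: kxy.
(* The order of [a] and [b] is unknown, as only the sets agree; each of [x] and [y] is [a] or [b],
   so [k a = k b] yields [k x = k y]. *)
have: x \in [set a; b] by rewrite ab set21.
have: y \in [set a; b] by rewrite ab set22.
by move=> /set2P[] -> /set2P[] ->.
Qed.

Lemma prod_indet_comp (V : finType) (phi : {perm V}) (k : {ffun V -> nat}) :
  \prod_(x : V) indet (coloring_comp V phi k x) = \prod_(x : V) indet (k x).
Proof.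
rewrite [RHS](reindex_inj (@perm_inj _ phi)) /=.
by apply: eq_bigr => x _; rewrite ffunE.
Qed.

Definition coloring_weight (V : finType) (m : {cmonom nat})
    (k : {ffun V -> nat}) : int :=
  mcoeff m (\prod_(x : V) indet (k x)).

Lemma coloring_weight_comp (V : finType) (phi : {perm V}) (m : {cmonom nat})
    (k : {ffun V -> nat}) :
  coloring_weight V m (coloring_comp V phi k) = coloring_weight V m k.
Proof. exact (f_equal (mcoeff m) (prod_indet_comp V phi k)). Qed.

Lemma chromatic_symmetric_functionE (V : finType) (E : {set {set V}})
    (m : {cmonom nat}) :
  chromatic_symmetric_function E m =
  \sum_(k \in [set k | proper_coloring E k]%classic) coloring_weight V m k.
Proof. by []. Qed.

Lemma graph_automorphismV (V : finType) (E : {set {set V}}) (phi : {perm V}) :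
  graph_automorphism E phi -> graph_automorphism E phi^-1%g.
Proof. by move=> aut x y; rewrite -aut !permKV. Qed.

Lemma imset_permV (V : finType) (phi : {perm V}) (A B : {set V}) :
  phi @: A = B -> phi^-1%g @: B = A.
Proof.
move=> <-; rewrite -imset_comp -[RHS]imset_id.
by apply: eq_imset => x /=; rewrite permK.
Qed.

(** Composing with [phi] gives [a] and [b] the colours that [k] gives [c] and [d], in some order,
    and equality ignores the order. *)
Lemma eq_coloring_comp (V : finType) (phi : {perm V}) (a b c d : V)
    (k : {ffun V -> nat}) :
  phi @: [set a; b] = [set c; d] ->
  (coloring_comp V phi k a == coloring_comp V phi k b) = (k c == k d).
Proof.
rewrite !ffunE imsetU1 imset_set1 => e.
have c_ab : c \in [set phi a; phi b] by rewrite e set21.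
have d_ab : d \in [set phi a; phi b] by rewrite e set22.
have /set2P a_cd : phi a \in [set c; d] by rewrite -e set21.
have /set2P b_cd : phi b \in [set c; d] by rewrite -e set22.
move: c_ab d_ab; case: a_cd b_cd => -> [] ->; rewrite !inE ?orbb //.
(* The cases left have [phi a = phi b], which forces [c = d]. *)
- by move=> _ /eqP->.
- by move=> /eqP->.
Qed.

(** The tested pair is a parameter so that the inverse is again a switch, by [phi^-1] on [u] and
    [w]. *)
Definition coloring_switch (V : finType) (phi : {perm V}) (v z : V)
    (k : {ffun V -> nat}) : {ffun V -> nat} :=
  if k v == k z then coloring_comp V phi k else k.

Lemma proper_coloring_switch (V : finType) (F : {set {set V}}) (u v w z : V)
    (phi : {perm V}) (k : {ffun V -> nat}) :
  graph_automorphism F phi ->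
  phi @: [set u; w] = [set v; z] -> phi @: [set v; z] = [set u; w] ->
  [set u; z] \in F ->
  proper_coloring F k -> k w <> k z -> k u <> k w ->
  let k' := coloring_switch V phi v z k in
  [/\ proper_coloring F k', k' w <> k' z & k' v <> k' z].
Proof.
move=> aut uw_vz vz_uw uzF kF kwz /eqP kuw; rewrite /coloring_switch.
case: (boolP (k v == k z)) => [kvz|/eqP kvz]; last by split.
have k'F := proper_coloring_comp V F phi k aut kF.
split=> //; last by apply/eqP; rewrite (eq_coloring_comp V phi v z u w).
(* The new colouring agrees at [u] and [w], so the goal turns into separating [u] from [z]. *)
move: kvz; rewrite -(eq_coloring_comp V phi u w v z) // => /eqP <-.
exact: k'F.2.
Qed.

(** The result agrees at [u] and [w] exactly when [k] was changed: an unchanged [k] still separates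
    them. Hence the second test undoes precisely the first change. *)
Lemma coloring_switchK (V : finType) (u v w z : V) (phi : {perm V})
    (k : {ffun V -> nat}) :
  phi @: [set u; w] = [set v; z] -> k u <> k w ->
  coloring_switch V phi^-1%g u w (coloring_switch V phi v z k) = k.
Proof.
move=> uw_vz /eqP/negbTE kuw; rewrite /coloring_switch.
case kvz: (k v == k z); last by rewrite kuw.
by rewrite (eq_coloring_comp V phi u w v z) // kvz coloring_compK.
Qed.

Theorem theorem4p2 (V : finType) (E : {set {set V}}) (hE : simple_graph E)
    (u v w z : V) (huniq : uniq [:: u; v; w; z])
    (huz : [set u; z] \in E) (hwz : [set w; z] \in E) (hvw : [set v; w] \in E)
    (huw : [set u; w] \notin E) (hvz : [set v; z] \notin E)
    (huv : [set u; v] \notin E)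
    (phi : {perm V}) (hphi : graph_automorphism (E :\ [set w; z]) phi)
    (hphi_uw : phi @: [set u; w] = [set v; z])
    (hphi_vz : phi @: [set v; z] = [set u; w]) :
  chromatic_symmetric_function (E :|: [set [set u; w]]) =
  chromatic_symmetric_function (E :|: [set [set v; z]]).
Proof.
set F := E :\ [set w; z] in hphi.
have proper_addE (a b : V) k : proper_coloring (E :|: [set [set a; b]]) k <->
    [/\ proper_coloring F k, k w <> k z & k a <> k b].
  (* Since [wz] is an edge, [E] is [F] with [wz] put back. *)
  rewrite finset.setUC proper_coloringU1 -(finset.setD1K hwz) proper_coloringU1.
  by split=> [[[]]|[]].
have [neq_uw neq_uz neq_vw neq_vz] : [/\ u != w, u != z, v != w & v != z].
  by move: huniq; rewrite /= !inE !negb_or => /and4P[/and3P[_ -> ->] /andP[-> ->]].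
have uzF : [set u; z] \in F.
  rewrite finset.in_setD1 huz andbT; apply/eqP => e.
  have: u \in [set w; z] by rewrite -e set21.
  by rewrite !inE (negbTE neq_uw) (negbTE neq_uz).
have vwF : [set v; w] \in F.
  rewrite finset.in_setD1 hvw andbT; apply/eqP => e.
  have: v \in [set w; z] by rewrite -e set21.
  by rewrite !inE (negbTE neq_vw) (negbTE neq_vz).
apply: funext => m; rewrite !chromatic_symmetric_functionE.
rewrite [RHS](reindex_fsbig (coloring_switch V phi v z)
  [set k | proper_coloring (E :|: [set [set u; w]])%SET k]%classic); last first.
  split=> [k /proper_addE[kF kwz kuw]|k l|k /proper_addE[kF kwz kvz]].
  - apply/proper_addE.
    exact: (proper_coloring_switch V F u v w z phi k).
  - move=> /set_mem/proper_addE[_ _ kuw] /set_mem/proper_addE[_ _ luw] kl.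
    have kK := coloring_switchK V u v w z phi k hphi_uw kuw.
    have lK := coloring_switchK V u v w z phi l hphi_uw luw.
    by rewrite -kK kl lK.
  (* Surjectivity: the situation is symmetric under [phi^-1] with [u], [v] exchanged and [w], [z]
     exchanged; the edge [vw] then takes the place of [uz]. *)
  have aut' := graph_automorphismV V F phi hphi.
  have uw' := imset_permV V phi _ _ hphi_uw.
  have vz' := imset_permV V phi _ _ hphi_vz.
  exists (coloring_switch V phi^-1%g u w k).
    have [||k'F k'zw k'uw] :=
      proper_coloring_switch V F v u z w phi^-1%g k aut' uw' vz' vwF kF => //.
      by move=> e; apply: kwz.
    by apply/proper_addE; split=> // e; apply: k'zw.
  have := coloring_switchK V v u z w phi^-1%g k uw' kvz.
  by rewrite invgK.
apply: eq_fsbigr => k _; rewrite /coloring_switch.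
by case: ifP => _; rewrite ?coloring_weight_comp.
Qed.
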